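(* Let $X$ be a $T_3$ Lindelöf $Q$-space such that $w(X)\leq\mathfrak{c}$. Then $|X|<\operatorname{cf}(\mathfrak{c})$.
   Context: A topological space $X$ is a $Q$-space if $X$ is not $\sigma$-discrete (i.e. $X$ is not a countable union of discrete subspaces) and every subset of $X$ is a $G_\delta$-set in $X$. $T_3$ means regular and $T_1$. $w(X)$ denotes the weight of $X$ (the minimum cardinality of a base, taken to be infinite), $\mathfrak{c}=2^{\omega}$ is the cardinality of the continuum, and $\operatorname{cf}(\mathfrak{c})$ is its cofinality. *)

(* Defs.v *)
From mathcomp Require Import all_boot all_classical.
From mathcomp Require Import wochoice topology borel_hierarchy.

Set Implicit Arguments.
Unset Strict Implicit.
Unset Printing Implicit Defensive.

Local Open Scope classical_set_scope.
Local Open Scope card_scope.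

Definition card_lt (T U : Type) (A : set T) (B : set U) : bool :=
  (A #<= B) && ~~ (B #<= A).

Notation "A '#<' B" := (card_lt A B)
  (at level 79, format "A  '#<'  B") : card_scope.

Section Cofinality.
Variable K : Type.
Implicit Types (R : rel K) (C D : set K).

(* The order type of R is the initial ordinal of the cardinal |K|. *)
Definition initial_well_order R :=
  well_order R /\ forall x, [set y | R y x /\ y <> x] #< [set: K].

Definition cofinal_set R C := forall x, exists2 y, C y & R x y.

(* C is a cofinal subset of least cardinality of the initial ordinal |K|; the
   cardinal |C| does not depend on R, since any two initial well-orders of K
   are isomorphic. *)
Definition is_cofinality C :=
  exists R, [/\ initial_well_order R, cofinal_set R C &
    forall D, cofinal_set R D -> C #<= D].

Lemma least_cardinality (T : Type) (P : set (set T)) :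
  P !=set0 -> exists2 A, P A & forall B, P B -> A #<= B.
Proof.
case=> A0 PA0.
have [[A PA /eqP A_0]|P_neq0] := pselect (exists2 A, P A & A == set0).
  by exists A => // B _; rewrite A_0 card_ge0.
have P_ne (B : set T) : P B -> B !=set0.
  by move=> PB; apply/set0P/negP => B0; apply: P_neq0; exists B.
pose Q (Z : set (set T -> T)) := forall B, P B ->
  (forall f, Z f -> B (f B)) /\ {in Z &, injective (fun f => f B)}.
have [F FQ tF|M [QM Mmax]] := @Zorn_bigcup _ Q.
  move=> B PB; split=> [f [Z FZ Zf]|f g].
    by have [+ _] := FQ _ FZ _ PB; apply.
  rewrite !inE => -[Z FZ Zf] [Y FY Yg] fg.
  have [ZY|YZ] := tF _ _ FZ FY.
    by have [_ +] := FQ _ FY _ PB; apply; rewrite ?inE //; exact: ZY.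
  by have [_ +] := FQ _ FZ _ PB; apply; rewrite ?inE //; exact: YZ.
have [[B PB BM]|noB] := pselect (exists2 B, P B & B `<=` [set f B | f in M]).
  exists B => // C PC; apply: (card_le_trans (subset_card_le BM)).
  apply: (card_le_trans (card_image_le _ _)).
  have [MC injM] := QM _ PC; rewrite -(card_le_eql (inj_card_eq injM)).
  by apply: subset_card_le => _ [f Mf <-]; exact: MC.
have hP (B : set T) : exists x, P B -> B x /\ ~ [set f B | f in M] x.
  have [PB|nPB] := pselect (P B); last first.
    by have [x _] := P_ne _ PA0; exists x.
  have : ~ (B `<=` [set f B | f in M]) by move=> BM; apply: noB; exists B.
  by move=> /existsNP[x /not_implyP[Bx nx]]; exists x.
have [h hh] := choice hP.
exfalso; apply: (Mmax (h |` M)).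
  split; first by move=> ? /=; right.
  by move=> /(_ h (or_introl erefl)) Mh; have [_ []] := hh _ PA0; exists h.
move=> B PB; have [MB injM] := QM _ PB; have [Bh nh] := hh _ PB.
split=> [_ [->//|/MB//]|f g].
rewrite !inE => -[->|Mf] [->|Mg] // fg.
- by case: nh; exists g.
- by case: nh; exists f.
- by apply: injM; rewrite ?inE.
Qed.

Lemma initial_well_order_exists : exists R, initial_well_order R.
Proof.
have [R0 wR0] := well_ordering_principle {classic K}.
have wR0' : @wo_chain {classic K} R0 predT by move=> A _; exact: wR0.
have R0xx x : R0 x x by apply: (wo_chain_reflexive wR0').
have R0anti x y : R0 x y -> R0 y x -> x = y.
  by move=> xy yx; apply: (wo_chain_antisymmetric wR0') => //; rewrite xy.
have R0tot x y : R0 x y || R0 y x by apply: (wo_chainW wR0').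
have R0trans x y z : R0 x y -> R0 y z -> R0 x z.
  move=> xy yz.
  have [|m [[mA mlb] _]] := wR0 [pred t | [|| t == x, t == y | t == z]].
    by exists x; rewrite inE eqxx.
  have [mx my mz] : [/\ R0 m x, R0 m y & R0 m z].
    by split; apply: mlb; rewrite inE eqxx ?orbT.
  move: mA; rewrite inE => /or3P[] /eqP me; subst m => //.
    by rewrite (R0anti _ _ xy mx).
  by rewrite -(R0anti _ _ yz my).
pose seg R (x : K) := [set y | R y x /\ y <> x].
have [big|small] := pselect (exists x, [set: K] #<= seg R0 x); last first.
  exists R0; split => // x; rewrite /card_lt card_leT/=.
  by apply/negP => xK; apply: small; exists x.
have [|x [[xB xlb] _]] := wR0 [pred x | [set: K] #<= seg R0 x].
  by case: big => x xK; exists x; exact: xK.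
have /card_leP[f] : [set: K] #<= seg R0 x := xB.
pose toK u : [set: K] := SigSub (mem_set (Logic.I : [set: K] u)).
pose g (u : K) : K := set_val (f (toK u) : seg R0 x).
have gx u : R0 (g u) x /\ g u <> x by exact: (set_mem (valP (f (toK u)))).
have ginj : injective g.
  move=> u v /val_inj /(@inj _ _ _ f) uv.
  by apply: (congr1 val (uv _ _)); exact: mem_set.
exists (fun u v => R0 (g u) (g v)); split.
  apply: antisymmetric_well_order => [u v /andP[uv vu]|A [a Aa]].
    by apply: ginj; exact: R0anti.
  have [|z [[zA zlb] _]] := wR0 [pred z | `[< exists2 a, a \in A & g a = z >]].
    by exists (g a); apply/asboolP; exists a.
  have [b Ab bz] := asboolW zA; exists b; split => // c Ac.
  by rewrite bz; apply: zlb; apply/asboolP; exists c.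
move=> u; rewrite /card_lt card_leT/=; apply/negP => Ku.
have gux : [set: K] #<= seg R0 (g u).
  apply: (card_le_trans Ku); rewrite -(card_le_eql (inj_card_eq (in2W ginj))).
  apply: subset_card_le => _ [v [vu nvu] <-]; split => // gvu.
  by apply: nvu; exact: ginj.
have [gux1 gux2] := gx u.
by apply: gux2; apply: R0anti => //; exact: xlb.
Qed.

Lemma is_cofinality_exists : exists C, is_cofinality C.
Proof.
have [R iR] := initial_well_order_exists.
have wR : @wo_chain {classic K} R predT by move=> A _; case: iR => + _; exact.
have [|C cC leC] := @least_cardinality K (cofinal_set R).
  by exists setT => x; exists x => //; apply: (wo_chain_reflexive wR).
by exists C, R.
Qed.

(* The cofinality of the cardinal |K|, represented by a set having that
   cardinality. *)
Definition cofinality : set K := projT1 (cid is_cofinality_exists).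

Lemma cofinalityP : is_cofinality cofinality.
Proof. exact: projT2 (cid is_cofinality_exists). Qed.

End Cofinality.

Arguments cofinality : clear implicits.

Section Spaces.
Variable X : topologicalType.

Definition lindelof_space :=
  forall U : set (set X), U `<=` open -> \bigcup_(A in U) A = setT ->
    exists2 V : set (set X), V `<=` U /\ countable V & \bigcup_(A in V) A = setT.

Definition discrete_subspace (A : set X) := forall B : set (set_type A), open B.

Definition sigma_discrete_space :=
  exists2 D : nat -> set X,
    (forall n, discrete_subspace (D n)) & \bigcup_n D n = setT.

Definition Q_space :=
  ~ sigma_discrete_space /\ forall A : set X, Gdelta A.

Definition T3_space := regular_space X /\ accessible_space X.

(* w(X) <= |K|, where w(X) is at least omega by convention *)
Definition weight_le (K : Type) :=
  [set: nat] #<= [set: K] /\ exists2 B : set (set X), basis B & B #<= [set: K].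

End Spaces.

(* Main.v *)
Require Import Defs.
From mathcomp Require Import all_boot all_classical.
From mathcomp Require Import topology borel_hierarchy.

(** Write c for the continuum.  The space has at most c subsets, and then
    König's theorem bounds its cardinality.

    All subsets of X being G_delta, every open set U is F_sigma, hence a
    countable union of closed subspaces of a Lindelöf space, hence itself
    Lindelöf: U is a countable union of members of any given base
    ([open_countable_union_basis]).  With a base of size at most c there are
    at most c^omega = c open sets, and again at most c^omega = c sets that are
    countable intersections of open sets; but these are all the subsets of X
    ([subsets_coded]).  So 2^|X| <= c, and therefore
    c^|X| = 2^(omega * |X|) = (2^|X|)^omega <= c^omega = c
    ([functions_coded]).

    König's diagonal argument ([cofinality_not_card_le]) shows that c^|X| <= c
    is incompatible with cf(c) <= |X|.  As cardinals are comparable,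
    |X| < cf(c). *)

Local Open Scope classical_set_scope.
Local Open Scope card_scope.

(** * Cardinals *)

(** Comparability of cardinals is the existence of a least one among two: both
    sets are copied into the disjoint sum, where the two copies form a family
    to which [least_cardinality] applies. *)
Lemma card_le_total {T U : Type} (A : set T) (B : set U) :
  A #<= B \/ B #<= A.
Proof.
have inlA : [set (inl x : T + U) | x in A] #= A.
  by apply: inj_card_eq => x y _ _ [].
have inrB : [set (inr x : T + U) | x in B] #= B.
  by apply: inj_card_eq => x y _ _ [].
have [|_ [->|->] le] := @least_cardinality (T + U)%type
  [set [set inl x | x in A]; [set inr x | x in B]].
- by exists [set inl x | x in A]; left.
- left; rewrite -(card_le_eql inlA) -(card_le_eqr inrB).
  by apply: le; right.
- right; rewrite -(card_le_eql inrB) -(card_le_eqr inlA).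
  by apply: le; left.
Qed.

Lemma card_lt_notsurj {T U : Type} {A : set T} {B : set U} (f : T -> U) :
  A #< B -> exists2 y, B y & forall x, A x -> f x <> y.
Proof.
case/andP=> _ /negP nBA; apply: contrapT => nex; apply: nBA.
apply: (card_le_trans _ (card_image_le f A)).
apply: subset_card_le => y By; apply: contrapT => nfy; apply: nex.
by exists y => // x Ax fxy; apply: nfy; exists x.
Qed.

(** König's theorem.  Suppose x |-> e x runs through a cofinal set, and let s
    enumerate the functions from X by K.  The diagonal function g differs at x
    from s k for every k <= e x, while each k lies below some e x.  Values in
    [bool * K] rather than in K allow for k = e x: the indices k < e x, being
    fewer than |K|, are avoided with the second component, and the index e x
    itself with the first. *)
Lemma cofinality_not_card_le {K X : Type} (s : K -> X -> bool * K) (k0 : K) :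
  set_surj setT setT s -> ~ (cofinality K #<= [set: X]).
Proof.
move=> ssurj; have [R [[_ small] cof _]] := cofinalityP K.
case/pfcard_geP => [C0|[e]].
  by have [y] := cof k0; rewrite C0.
have avoid x : exists y, forall k, R k (e x) /\ k <> e x -> (s k x).2 <> y.
  by have [y _ ny] := card_lt_notsurj (fun k => (s k x).2) (small (e x)); exists y.
have [d dP] := choice avoid.
have [k _ sk] := ssurj (fun x => (~~ (s (e x) x).1, d x)) I.
have [_ /(@surj _ _ _ _ e)[x _ <-] kx] := cof k.
have [kE|kNE] := pselect (k = e x).
  have := congr1 (fun g => (g x).1) sk; rewrite -kE /=.
  by case: (s k x).1.
by apply: (dP x k) => //; rewrite sk.
Qed.

(** * Subsets of a Lindelöf space all of whose subsets are G_delta *)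

(** The complement of U is the intersection of open sets G i.  For each i, the
    members of B inside U together with G i cover the space; a countable
    subcover covers the complement of G i with members of B inside U, and
    these complements exhaust U. *)
Lemma open_countable_union_basis {X : topologicalType} {B : set (set X)}
    {U : set X} :
  lindelof_space X -> basis B -> open U -> Gdelta (~` U) ->
  exists W : set (set X), [/\ W `<=` B, countable W & U = \bigcup_(A in W) A].
Proof.
move=> hL [Bopen Bbasis] oU [G oG UG].
pose BU := [set A | B A /\ A `<=` U].
have subcover i : exists V : set (set X),
    [/\ V `<=` BU `|` [set G i], countable V & \bigcup_(A in V) A = setT].
  have [||V [VU cV] Vcov] := hL (BU `|` [set G i]).
  - by move=> A [[/Bopen]|->//].
  - apply/seteqP; split=> // x _.
    have [Ux|nUx] := pselect (U x); last first.
      exists (G i); first by right.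
      by have : (~` U) x := nUx; rewrite UG; apply.
    have [A [BA Ax] AU] := Bbasis x U (open_nbhs_nbhs (conj oU Ux)).
    by exists A => //; left.
  - by exists V.
have [V VP] := choice subcover.
exists (BU `&` \bigcup_i V i); split.
- by move=> A [[]].
- apply: (sub_countable (subset_card_le (@subIsetr _ _ _))).
  by apply: bigcup_countable => // i _; have [] := VP i.
apply/seteqP; split=> [x Ux|x [A [[_ AU] _]]]; last exact: AU.
have [i nGx] : exists i, ~ G i x.
  apply: contrapT => /forallNP Gx; have : (~` U) x.
    by rewrite UG => i _; apply: contrapT; exact: Gx.
  by [].
have [VBU _ cov] := VP i.
have [A VA Ax] : (\bigcup_(A in V i) A) x by rewrite cov.
exists A => //; split; last by exists i.
by case: (VBU A VA) => // AG; rewrite AG in Ax.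
Qed.

(** A subset is a G_delta set whose open sets are countable unions of basic
    sets, so a doubly indexed sequence of codes of basic sets describes it. *)
Lemma subsets_coded {X : topologicalType} :
  lindelof_space X -> (forall A : set X, Gdelta A) ->
  weight_le X (nat -> bool) ->
  exists D : (nat -> nat -> nat -> bool) -> set X, set_surj setT setT D.
Proof.
move=> hL hG [_ [B bB cB]].
(* The first bit of a code is reserved for the empty set, which pads the
   enumeration of an empty family of basic sets. *)
have [p pB p0] : exists2 p : (nat -> bool) -> set X,
    (forall A, B A -> exists k, p k = A) & (exists k, p k = set0).
  have [q qB] : exists q : (nat -> bool) -> set X,
      forall A, B A -> exists k, q k = A.
    have /pcard_surjP[q qB] := cB.
    by exists q => A /qB[k _ <-]; exists k.
  exists (fun k => if k 0 then q (fun n => k n.+1) else set0).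
    move=> A /qB[k <-]; exists (fun n => if n is m.+1 then k m else true).
    by [].
  by exists (fun=> false).
have open_coded U : open U -> exists f : nat -> nat -> bool, \bigcup_j p (f j) = U.
  move=> oU.
  have [W [WB cW ->]] := open_countable_union_basis hL bB oU (hG _).
  case/pfcard_geP: cW => [->|[w]].
    have [k0 pk0] := p0; exists (fun=> k0).
    by rewrite bigcup_set0 bigcup0.
  have /choice[f fP] j : exists k, p k = w j by apply/pB/WB; exact: funS.
  exists f; apply/seteqP; split=> [x [j _]|x [A /(@surj _ _ _ _ w)[j _ <-] Ax]].
    by rewrite fP => wx; exists (w j) => //; exact: funS.
  by exists j => //; rewrite fP.
exists (fun F => \bigcap_i \bigcup_j p (F i j)) => A _.
have [G oG ->] := hG A.
have [F FP] := choice (fun i => open_coded (G i) (oG i)).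
by exists F => //; apply: eq_bigcapr => i _; rewrite FP.
Qed.

(** Counted by exponents: (2^omega)^|X| = (2^|X|)^omega, and a sequence of
    subsets of X, each with a triply indexed code, is coded by one sequence of
    bits through an encoding of quadruples of natural numbers. *)
Lemma functions_coded {X : Type} (D : (nat -> nat -> nat -> bool) -> set X) :
  set_surj setT setT D ->
  exists s : (nat -> bool) -> X -> bool * (nat -> bool), set_surj setT setT s.
Proof.
move=> Dsurj.
pose S (k : nat -> bool) (n : nat) : set X :=
  D (fun a b c => k (pickle (n, a, b, c))).
exists (fun k x => (`[< S k 0 x >], fun n => `[< S k n.+1 x >])) => g _.
pose Sg n : set X :=
  if n is m.+1 then [set x | (g x).2 m] else [set x | (g x).1].
have /choice[F FP] n : exists F, D F = Sg n.
  by have [F _ <-] := Dsurj (Sg n) I; exists F.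
pose k m := if @unpickle (nat * nat * nat * nat)%type m is Some (n, a, b, c)
  then F n a b c else false.
have kP n : S k n = Sg n.
  rewrite -FP /S; congr D; apply/funext => a; apply/funext => b.
  by apply/funext => c; rewrite /k pickleK.
exists k => //; apply/funext => x; rewrite kP /= asboolb.
rewrite [RHS]surjective_pairing; congr pair.
by apply/funext => n; rewrite kP /= asboolb.
Qed.

(** * The cardinality bound *)

Theorem theorem4p2 (X : topologicalType) (hT3 : T3_space X)
    (hL : lindelof_space X) (hQ : Q_space X) (hw : weight_le X (nat -> bool)) :
  [set: X] #< cofinality (nat -> bool).
Proof.
have [_ hG] := hQ.
have [D Dsurj] := subsets_coded hL hG hw.
have [s ssurj] := functions_coded D Dsurj.
have nle := cofinality_not_card_le s (fun=> false) ssurj.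
apply/andP; split; last exact/negP.
by have [|/nle] := card_le_total [set: X] (cofinality (nat -> bool)).
Qed.
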